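(* Let $F$ be a field and $P\in F[t]$ a polynomial of degree $d\ge 1$. For each $z\in \hat K^{\times}$ there exist a unique $N\in\mathbb{Z}_{\ge 0}\cup\{\infty\}$ and a unique sequence $\{(n_i,f_i)\}_{i=1}^{N}$ of pairs with $n_i\in\mathbb{Z}$, $f_i\in A_d$, $f_i\neq 0$, such that $\deg(f_i)-n_id>0$ for all $i>1$ and $$z=[n_1,f_1,n_2,f_2,\dots]_{\mathrm{ev}}.$$ Moreover, $N$ is finite if and only if $z\in K$. In both cases (finite or infinite $N$), if we write $x_r(z)=[n_1,f_1,\dots,n_r,f_r]_{\mathrm{ev}}$, then for every integer $r$ with $0\le r<N$, $$\nu\big(z-x_r(z)\big)=2\sum_{i=1}^{r}\deg(f_i)+\deg(f_{r+1})-\sum_{i=1}^{r+1}n_id .$$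
   Context: Notation: $A=F[t]$, $K=F(t)$, $\hat K=F(\!(t^{-1})\!)$ is the completion of $K$ with respect to the valuation $\nu$ given by $\nu(f/g)=\deg(g)-\deg(f)$ for $f,g\in A$, $g\ne 0$ (extended to $\hat K$, with $\nu(0)=\infty$). $A_d=\{Q\in F[t]:\deg Q<d\}$. For a finite sequence of pairs $(n_i,f_i)\in\mathbb{Z}\times A_d$, $[n_1,f_1,\dots,n_r,f_r]_{\mathrm{ev}}\in K$ denotes the value of the finite continued fraction $$\cfrac{P^{n_1}}{f_1+\cfrac{P^{n_2}}{f_2+\cfrac{\ddots}{\ddots+\cfrac{P^{n_r}}{f_r}}}},$$ with the convention that the empty continued fraction ($r=0$) has value $0$. For an infinite sequence, $[n_1,f_1,n_2,f_2,\dots]_{\mathrm{ev}}$ denotes the limit in $\hat K$ of $[n_1,f_1,\dots,n_r,f_r]_{\mathrm{ev}}$ as $r\to\infty$, when it exists. If $N$ is finite, $[n_1,f_1,n_2,f_2,\dots]$ means the finite continued fraction $[n_1,f_1,\dots,n_N,f_N]$. *)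

(* Defs.v *)
From HB Require Import structures.
From mathcomp Require Import all_boot all_order all_algebra.
From mathcomp Require Import generic_quotient.
From mathcomp Require Import boolp classical_sets functions cardinality fsbigop.
From mathcomp Require Import constructive_ereal.
From mathcomp Require Import zify ring.

Set Implicit Arguments.
Unset Strict Implicit.
Unset Printing Implicit Defensive.

Import Order.TTheory GRing.Theory Num.Theory.
Local Open Scope ring_scope.
Local Open Scope classical_set_scope.

Local Notation "x %:F" := (FracField.tofrac x).

(** * The field F((t^-1)) of formal Laurent series in t^-1 *)

(* [coefl z n] is the coefficient of t^n (and not of t^-n): the coefficients
   vanish for all large n. *)
Record laurent (F : fieldType) := Laurent {
  coefl :> int -> F;
  coefl_bounded : exists b : int, forall n, b < n -> coefl n = 0 }.

HB.instance Definition _ (F : fieldType) := gen_eqMixin (laurent F).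
HB.instance Definition _ (F : fieldType) := gen_choiceMixin (laurent F).

Section Laurent.
Variable F : fieldType.
Implicit Types (f g h : int -> F) (x y z : laurent F) (M N : int).

Lemma laurentP x y : x =1 y -> x = y.
Proof.
case: x y => [f fb] [g gb] /= /funext efg; rewrite {}efg in fb *.
by congr Laurent; exact: Prop_irrelevance.
Qed.

Definition bndl f M := forall n, M < n -> f n = 0.

Definition truncl M (K : nat) f : {poly F} := \poly_(i < K) f (M - i%:Z).

(* Cauchy product; the sum has finite support if f and g are bounded above. *)
Definition mulf f g : int -> F := fun n => \sum_(i \in [set: int]) (f i * g (n - i)).

Lemma mulfE f g M N (K k : nat) : bndl f M -> bndl g N -> (k < K)%N ->
  mulf f g (M + N - k%:Z) = (truncl M K f * truncl N K g)`_k.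
Proof.
move=> bf bg kK; rewrite /mulf.
rewrite (fsbigE [seq M - i%:Z | i <- index_iota 0 k.+1]).
- rewrite (eq_bigl xpredT) ?big_map; last by move=> i; rewrite in_setT.
  rewrite big_mkord coefM; apply: eq_bigr => -[i /= ik] _.
  rewrite !coef_poly !ifT; [|lia|lia].
  by congr (_ * g _); lia.
- rewrite map_inj_in_uniq ?iota_uniq// => i j _ _; lia.
- by [].
- move=> i _ /mapP ni; have [Mi|iM] := ltP M i; first by rewrite bf ?mul0r.
  have [ki|ik] := ltP (M - i) (k%:Z + 1); last by rewrite bg ?mulr0//; lia.
  case: ni; exists `|(M - i)%R|%N; last lia.
  by rewrite mem_index_iota; lia.
Qed.

Lemma mulf_bnd f g M N : bndl f M -> bndl g N -> bndl (mulf f g) (M + N).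
Proof.
move=> bf bg n MN; rewrite /mulf fsbig1// => i _.
have [Mi|iM] := ltP M i; first by rewrite bf ?mul0r.
by rewrite bg ?mulr0//; lia.
Qed.

Lemma truncl_mulf f g M N (K k : nat) : bndl f M -> bndl g N -> (k < K)%N ->
  (truncl (M + N) K (mulf f g))`_k = (truncl M K f * truncl N K g)`_k.
Proof. by move=> bf bg kK; rewrite coef_poly kK (mulfE bf bg kK). Qed.

Lemma coefM_eq (p p' q q' : {poly F}) K :
  (forall i, (i < K)%N -> p`_i = p'`_i) -> (forall i, (i < K)%N -> q`_i = q'`_i) ->
  forall i, (i < K)%N -> (p * q)`_i = (p' * q')`_i.
Proof.
move=> ep eq i iK; rewrite !coefM; apply: eq_bigr => -[j /= ji] _.
by rewrite ep ?eq//; lia.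
Qed.

Fact zerol_bounded : exists b : int, bndl (fun=> 0) b.
Proof. by exists 0. Qed.
Definition zerol := Laurent zerol_bounded.

Fact onel_bounded : exists b : int, bndl (fun n => (n == 0)%:R) b.
Proof. by exists 0 => n n0; rewrite gt_eqF. Qed.
Definition onel := Laurent onel_bounded.

Fact oppl_bounded x : exists b : int, bndl (fun n => - x n) b.
Proof. by case: (coefl_bounded x) => b xb; exists b => n /xb ->; rewrite oppr0. Qed.
Definition oppl x := Laurent (oppl_bounded x).

Fact addl_bounded x y : exists b : int, bndl (fun n => x n + y n) b.
Proof.
case: (coefl_bounded x) (coefl_bounded y) => [a xa] [b yb].
exists (Num.max a b) => n; rewrite gt_max => /andP[/xa -> /yb ->].
by rewrite addr0.
Qed.
Definition addl x y := Laurent (addl_bounded x y).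

Fact mull_bounded x y : exists b : int, bndl (mulf x y) b.
Proof.
case: (coefl_bounded x) (coefl_bounded y) => [a xa] [b yb].
by exists (a + b); apply: mulf_bnd.
Qed.
Definition mull x y := Laurent (mull_bounded x y).

Fact addlA : associative addl.
Proof. by move=> x y z; apply: laurentP => n /=; rewrite addrA. Qed.
Fact addlC : commutative addl.
Proof. by move=> x y; apply: laurentP => n /=; rewrite addrC. Qed.
Fact add0l : left_id zerol addl.
Proof. by move=> x; apply: laurentP => n /=; rewrite add0r. Qed.
Fact addNl : left_inverse zerol oppl addl.
Proof. by move=> x; apply: laurentP => n /=; rewrite addNr. Qed.

HB.instance Definition _ := GRing.isZmodule.Build (laurent F) addlA addlC add0l addNl.

Lemma bnd_idx f M n : bndl f M -> f n = 0 \/ exists k : nat, n = M - k%:Z.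
Proof.
move=> bf; have [/bf|nM] := ltP M n; first by left.
by right; exists `|(M - n)%R|%N; lia.
Qed.

Fact mullC : commutative mull.
Proof.
move=> x y; apply: laurentP => n /=.
case: (coefl_bounded x) (coefl_bounded y) => [M xM] [N yN].
have bxy := mulf_bnd xM yN; have byx := mulf_bnd yN xM.
have [Mn|nM] := ltP (M + N) n; first by rewrite bxy ?byx//; lia.
have [k ->] : exists k : nat, n = M + N - k%:Z by exists `|(M + N - n)%R|%N; lia.
by rewrite (mulfE xM yN (ltnSn k)) (addrC M N) (mulfE yN xM (ltnSn k)) mulrC.
Qed.

Fact mullA : associative mull.
Proof.
move=> x y z; apply: laurentP => n /=.
case: (coefl_bounded x) (coefl_bounded y) (coefl_bounded z) => [M xM] [N yN] [L zL].
have bxy := mulf_bnd xM yN; have byz := mulf_bnd yN zL.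
have [Mn|nM] := ltP (M + N + L) n.
  by rewrite (mulf_bnd xM byz) ?(mulf_bnd bxy zL)//; lia.
have [k ->] : exists k : nat, n = M + N + L - k%:Z.
  by exists `|(M + N + L - n)%R|%N; lia.
rewrite (mulfE bxy zL (ltnSn _)) -(addrA M N L) (mulfE xM byz (ltnSn _)).
rewrite (coefM_eq (p' := truncl M k.+1 x)
  (q' := truncl N k.+1 y * truncl L k.+1 z) (K := k.+1))//; last first.
  by move=> i ik; apply: truncl_mulf.
rewrite mulrA; symmetry; apply: (coefM_eq (K := k.+1)) => // i ik.
exact: truncl_mulf.
Qed.

Fact mul1l : left_id onel mull.
Proof.
move=> x; apply: laurentP => n /=; rewrite /mulf.
rewrite (fsbigE [:: 0]) /=; [|by []|by []|].
  by rewrite big_mkcond big_cons big_nil in_setT eqxx mul1r subr0 Monoid.mulm1.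
by move=> i _; rewrite inE => /negPf ->; rewrite mul0r.
Qed.

Fact mullDl : left_distributive mull addl.
Proof.
move=> x y z; apply: laurentP => n /=.
case: (coefl_bounded x) (coefl_bounded y) (coefl_bounded z) => [a xa] [b yb] [L zL].
pose M := Num.max a b.
have xM : bndl x M by move=> i; rewrite gt_max => /andP[/xa].
have yM : bndl y M by move=> i; rewrite gt_max => /andP[_ /yb].
have xyM : bndl (fun n => x n + y n) M by move=> i iM; rewrite xM// yM// addr0.
have [Mn|nM] := ltP (M + L) n.
  by rewrite !(mulf_bnd _ zL Mn)// addr0.
have [k ->] : exists k : nat, n = M + L - k%:Z by exists `|(M + L - n)%R|%N; lia.
rewrite (mulfE xyM zL (ltnSn k)) (mulfE xM zL (ltnSn k)) (mulfE yM zL (ltnSn k)).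
rewrite -coefD -mulrDl; congr (nth 0 (polyseq (_ * _)) k).
by apply/polyP => i; rewrite coefD !coef_poly; case: ifP; rewrite ?addr0.
Qed.

Fact onel_neq0 : onel != 0.
Proof.
apply/eqP => /(congr1 (fun x : laurent F => x 0)) /= /eqP.
by rewrite oner_eq0.
Qed.

HB.instance Definition _ :=
  GRing.Zmodule_isComNzRing.Build (laurent F) mullA mullC mul1l mullDl onel_neq0.

Lemma coefl0 n : (0 : laurent F) n = 0. Proof. by []. Qed.
Lemma coefl1 n : (1 : laurent F) n = (n == 0)%:R. Proof. by []. Qed.
Lemma coeflD x y n : (x + y) n = x n + y n. Proof. by []. Qed.
Lemma coeflN x n : (- x) n = - x n. Proof. by []. Qed.
Lemma coeflB x y n : (x - y) n = x n - y n. Proof. by []. Qed.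
Lemma coeflM x y n : (x * y) n = \sum_(i \in [set: int]) (x i * y (n - i)).
Proof. by []. Qed.

Definition is_degl x (m : int) := x m != 0 /\ bndl x m.

Lemma is_degl_uniq x m n : is_degl x m -> is_degl x n -> m = n.
Proof.
move=> [xm bm] [xn bn]; have [/bm x0|/bn x0|//] := ltgtP m n.
  by rewrite x0 eqxx in xn.
by rewrite x0 eqxx in xm.
Qed.

Lemma is_degl_ex x : x != 0 -> exists m, is_degl x m.
Proof.
move=> x0; case: (coefl_bounded x) => M xM.
have /existsNP[n /eqP xn] : ~ forall n, x n = 0.
  by move=> h; move/eqP: x0; apply; apply: laurentP.
have [k ek] : exists k : nat, n = M - k%:Z.
  by case: (bnd_idx n xM) => // h; rewrite h eqxx in xn.
have exk : exists k : nat, x (M - k%:Z) != 0 by exists k; rewrite -ek.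
exists (M - (ex_minn exk)%:Z); case: ex_minnP => j xj jmin; split => // i ji.
have [//|[l el]] := bnd_idx i xM; apply/eqP/negPn/negP => xi.
by have := jmin l; rewrite -el => /(_ xi); lia.
Qed.

(* Successive approximations of the inverse of the power series a. *)
Fixpoint ps_inv (a : nat -> F) (k : nat) : {poly F} :=
  if k is k'.+1 then
    ps_inv a k' -
      ((\poly_(i < k.+1) a i * ps_inv a k')`_k / a 0%N) *: 'X^k
  else ((a 0%N)^-1)%:P.

Lemma ps_invP a k i : a 0%N != 0 -> (i <= k)%N ->
  (\poly_(j < k.+1) a j * ps_inv a k)`_i = (i == 0%N)%:R.
Proof.
move=> a0; elim: k i => [|k IH] i.
  rewrite leqn0 => /eqP -> /=; rewrite coefM big_ord1 coefC coef_poly /=.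
  by rewrite mulfV.
rewrite leq_eqVlt => /orP[/eqP ->|ik] /=.
  rewrite mulrBr coefB -scalerAr coefZ coefMXn ltnn subnn coef_poly /=.
  by rewrite divfK// subrr.
rewrite mulrBr coefB -scalerAr coefZ coefMXn ik mulr0 subr0.
rewrite -IH//; apply: (coefM_eq (K := k.+1)) => // j jk.
by rewrite !coef_poly jk ltnS ltnW.
Qed.

Lemma ps_inv_stable a k i : (i <= k)%N -> (ps_inv a k)`_i = (ps_inv a i)`_i.
Proof.
elim: k => [|k IH]; first by rewrite leqn0 => /eqP ->.
rewrite leq_eqVlt => /orP[/eqP ->//|ik] /=.
by rewrite coefB coefZ coefXn ltn_eqF// mulr0 subr0 IH.
Qed.

Lemma mull_inv_ex x : x != 0 -> exists y, y * x = 1.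
Proof.
move=> /is_degl_ex[m [xm bx]].
pose a (i : nat) := x (m - i%:Z).
have a0 : a 0%N != 0 by rewrite /a subr0.
pose g (n : int) := if n + m <= 0 then (ps_inv a `|(n + m)%R|)`_`|(n + m)%R| else 0.
have bg : bndl g (- m) by move=> n mn; rewrite /g ifF//; lia.
exists (Laurent (ex_intro _ (- m) bg)); rewrite mulrC; apply: laurentP => n.
rewrite coefl1 /=.
have bxg := mulf_bnd bx bg.
have [Mn|nM] := ltP (m + - m) n; first by rewrite bxg// gt_eqF//; lia.
have [k ->] : exists k : nat, n = m + - m - k%:Z.
  by exists `|(m + - m - n)%R|%N; lia.
rewrite (mulfE bx bg (ltnSn k)).
have -> : (m + - m - k%:Z == 0) = (k == 0)%N by lia.
rewrite -(ps_invP a0 (leqnn k)); apply: (coefM_eq (K := k.+1)) => // i ik.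
rewrite coef_poly ik ps_inv_stable// /g ifT; last lia.
by have -> : `|(- m - i%:Z + m)%R|%N = i by lia.
Qed.

Definition invl x := xget 0 [set y | y * x = 1].

Fact mulVl x : x != 0 -> invl x * x = 1.
Proof. by move=> /mull_inv_ex x0; rewrite /invl; case: xgetP => // h; case: x0 => y /h. Qed.

Fact invl0 : invl 0 = 0.
Proof.
rewrite /invl; case: xgetP => // y _ /=; rewrite mulr0 => /esym/eqP.
by rewrite oner_eq0.
Qed.

HB.instance Definition _ := GRing.ComNzRing_isField.Build (laurent F) mulVl invl0.

(** * The valuation on F((t^-1)) *)

(* The exponent of the leading term of x; junk value 0 if x = 0. *)
Definition degl x : int := xget 0 [set m | x m != 0 /\ forall n, m < n -> x n = 0].

Definition nu x : \bar int := if x == 0 then +oo%E else (- degl x)%:E.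

Lemma deglP x : x != 0 -> is_degl x (degl x).
Proof. by move=> /is_degl_ex; apply: xgetPex. Qed.

Lemma degl_eq x m : is_degl x m -> degl x = m.
Proof. by move=> xm; apply: xget_unique => // n /is_degl_uniq; apply. Qed.

Lemma nu_eq x m : is_degl x m -> nu x = (- m)%:E.
Proof.
move=> xm; rewrite /nu (degl_eq xm) ifF//; apply/negP => /eqP x0.
by case: xm; rewrite x0 coefl0 eqxx.
Qed.

Lemma nu0 : nu 0 = +oo%E. Proof. by rewrite /nu eqxx. Qed.

Lemma is_deglM x y m n : is_degl x m -> is_degl y n -> is_degl (x * y) (m + n).
Proof.
move=> [xm bx] [yn byy]; split; last exact: mulf_bnd.
have := mulfE bx byy (ltn0Sn 0); rewrite subr0 coefM big_ord1 !coef_poly /=.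
by rewrite !subr0 => ->; rewrite mulf_neq0.
Qed.

Lemma nuM x y : nu (x * y) = (nu x + nu y)%E.
Proof.
have [->|x0] := eqVneq x 0; first by rewrite mul0r nu0 /nu; case: eqP.
have [->|y0] := eqVneq y 0; first by rewrite mulr0 nu0 /nu; case: eqP.
have dx := deglP x0; have dy := deglP y0.
by rewrite (nu_eq (is_deglM dx dy)) (nu_eq dx) (nu_eq dy) opprD.
Qed.

(* Convergence for the topology defined by nu. *)
Definition cvgl (u : nat -> laurent F) (z : laurent F) :=
  forall M : int, exists R : nat, forall r, (R <= r)%N -> (M%:E <= nu (z - u r)%R)%E.

(** * The embedding of F(t) into F((t^-1)) *)

Fact polyl_bounded (p : {poly F}) :
  exists b : int, bndl (fun n => if n is Posz k then p`_k else 0) b.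
Proof.
exists (size p)%:Z => -[k|//]; rewrite ltz_nat => /ltnW; exact: nth_default.
Qed.
Definition polyl (p : {poly F}) : laurent F := Laurent (polyl_bounded p).

Fact polyl_is_zmod_morphism : zmod_morphism polyl.
Proof.
move=> p q; apply: laurentP => -[k|k] /=; first by rewrite coefB.
by rewrite subr0.
Qed.

Fact polyl_is_monoid_morphism : monoid_morphism polyl.
Proof.
split=> [|p q]; apply: laurentP => n.
  by rewrite coefl1; case: n => [k|k] //=; rewrite coef1.
rewrite coeflM; case: n => [k|k] /=; last first.
  rewrite fsbig1// => -[i|i] _; last by rewrite mul0r.
  have -> : Negz k - Posz i = Negz (k + i) by lia.
  by rewrite mulr0.
rewrite (fsbigE [seq i%:Z | i <- index_iota 0 k.+1]); [|by rewrite map_inj_uniq ?iota_uniq// => i j []|by []|].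
  rewrite (eq_bigl xpredT) ?big_map; last by move=> i; rewrite in_setT.
  rewrite big_mkord coefM; apply: eq_bigr => -[i /= ik] _.
  by have -> : k%:Z - i%:Z = (k - i)%N%:Z by lia.
move=> [i|i] _ ni; last by rewrite mul0r.
have ki : (k < i)%N.
  rewrite ltnNge; apply/negP => ik; move/mapP: ni; apply; exists i => //.
  by rewrite mem_index_iota.
have -> : k%:Z - i%:Z = Negz (i - k).-1 by lia.
by rewrite mulr0.
Qed.

HB.instance Definition _ :=
  GRing.isZmodMorphism.Build {poly F} (laurent F) polyl polyl_is_zmod_morphism.
HB.instance Definition _ :=
  GRing.isMonoidMorphism.Build {poly F} (laurent F) polyl polyl_is_monoid_morphism.

Lemma is_degl_polyl (p : {poly F}) : p != 0 -> is_degl (polyl p) (size p).-1%:Z.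
Proof.
move=> p0; split; first by rewrite /= -lead_coefE lead_coef_eq0.
move=> [k|//] /= pk; rewrite nth_default//.
by rewrite -size_poly_gt0 in p0; lia.
Qed.

Lemma polyl_eq0 (p : {poly F}) : (polyl p == 0) = (p == 0).
Proof.
apply/eqP/eqP => [h|->]; last exact: rmorph0.
apply/eqP/negPn/negP => /is_degl_polyl[/eqP nz _]; apply: nz.
by rewrite h.
Qed.

Definition fracl (x : {fraction {poly F}}) : laurent F :=
  polyl (\n_(repr x)) / polyl (\d_(repr x)).

Lemma fracE (x : {fraction {poly F}}) : x = (\n_(repr x))%:F / (\d_(repr x))%:F.
Proof.
have d0 : (\d_(repr x))%:F != 0 by rewrite tofrac_eq0 denom_ratioP.
apply: (canRL (mulfK d0)); rewrite -{1}[x]reprK; unlock FracField.tofrac.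
rewrite -[LHS]FracField.pi_mul; apply/eqmodP; rewrite /= FracField.equivfE.
rewrite /FracField.mulf !numden_Ratio ?oner_eq0 ?mulr1 ?mul1r ?denom_ratioP//.
by rewrite mulrC.
Qed.

Lemma fracl_div (p q : {poly F}) : q != 0 ->
  fracl (p%:F / q%:F) = polyl p / polyl q.
Proof.
move=> q0; set x := _ / _.
have d0 : \d_(repr x) != 0 by exact: denom_ratioP.
have /eqP := fracE x; rewrite {1}/x eqr_div ?tofrac_eq0// -!tofracM tofrac_eq.
move=> /eqP /(congr1 polyl); rewrite !rmorphM/= => e.
by apply/eqP; rewrite /fracl eq_sym eqr_div ?polyl_eq0// e.
Qed.

Lemma fracl_tofrac (p : {poly F}) : fracl p%:F = polyl p.
Proof.
by have := fracl_div p (oner_neq0 _); rewrite tofrac1 rmorph1 !divr1.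
Qed.

Fact fracl_is_zmod_morphism : zmod_morphism fracl.
Proof.
move=> x y; rewrite [x in LHS]fracE [y in LHS]fracE.
have dx : \d_(repr x) != 0 by exact: denom_ratioP.
have dy : \d_(repr y) != 0 by exact: denom_ratioP.
rewrite -mulNr addf_div ?tofrac_eq0// -tofracN -!tofracM -tofracD.
rewrite fracl_div ?mulf_neq0// rmorphD !rmorphM rmorphN/=.
by rewrite -addf_div ?polyl_eq0// mulNr.
Qed.

Fact fracl_is_monoid_morphism : monoid_morphism fracl.
Proof.
split=> [|x y]; first by rewrite -tofrac1 fracl_tofrac rmorph1.
rewrite [x in LHS]fracE [y in LHS]fracE.
have dx : \d_(repr x) != 0 by exact: denom_ratioP.
have dy : \d_(repr y) != 0 by exact: denom_ratioP.
rewrite mulf_div -!tofracM fracl_div ?mulf_neq0// !rmorphM/=.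
by rewrite -mulf_div.
Qed.

HB.instance Definition _ :=
  GRing.isZmodMorphism.Build {fraction {poly F}} (laurent F) fracl
    fracl_is_zmod_morphism.
HB.instance Definition _ :=
  GRing.isMonoidMorphism.Build {fraction {poly F}} (laurent F) fracl
    fracl_is_monoid_morphism.

Lemma nu_fracl (p q : {poly F}) : p != 0 -> q != 0 ->
  nu (fracl (p%:F / q%:F)) = ((size q).-1%:Z - (size p).-1%:Z)%:E.
Proof.
move=> p0 q0; rewrite fracl_div//.
have := nuM (polyl p / polyl q) (polyl q); rewrite divfK ?polyl_eq0//.
have pq0 : polyl p / polyl q != 0 by rewrite mulf_neq0 ?invr_eq0 ?polyl_eq0.
rewrite (nu_eq (is_degl_polyl p0)) (nu_eq (is_degl_polyl q0)).
by rewrite (nu_eq (deglP pq0)) => -[e]; rewrite -[- degl _](subrK (size q).-1%:Z) -e addrC.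
Qed.

End Laurent.

(** * Finite or infinite sequences *)

(* A sequence (a_i), 1 <= i <= N, with N a natural number ([FinSeq]) or infinity
   ([InfSeq]).  Indices start from 0: [fiterm s i] is a_(i+1). *)
Inductive fiseq (T : Type) := FinSeq of seq T | InfSeq of (nat -> T).

Section FiniteOrInfiniteSequences.
Variable T : Type.
Implicit Type s : fiseq T.

Definition is_fin s : bool := if s is FinSeq _ then true else false.

Definition lt_length (i : nat) s : bool :=
  if s is FinSeq l then (i < size l)%N else true.

(* x0 is returned when i is out of bounds. *)
Definition fiterm (x0 : T) s (i : nat) : T :=
  match s with FinSeq l => nth x0 l i | InfSeq u => u i end.

Definition fitake (r : nat) s : seq T :=
  match s with FinSeq l => take r l | InfSeq u => mkseq u r end.

End FiniteOrInfiniteSequences.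

(** * P-adic continued fractions *)

Section ContinuedFractions.
Variable F : fieldType.
Implicit Type s : fiseq (int * {poly F}).

Definition cf_n s (i : nat) : int := (fiterm (0, 0) s i).1.
Definition cf_f s (i : nat) : {poly F} := (fiterm (0, 0) s i).2.

(* The degree, used only for nonzero polynomials (deg 0 = 0 here). *)
Definition deg (Q : {poly F}) : int := (size Q).-1%:Z.

Definition A_ (d : nat) : {pred {poly F}} := [pred Q : {poly F} | size Q <= d]%N.

(* Division by zero (x / 0 = 0) does not occur for the admissible sequences
   below: by induction, each tail value has valuation > 0 whereas the digit in
   front of it is a nonzero polynomial, of valuation <= 0. *)
Fixpoint cf_ev (P : {poly F}) (l : seq (int * {poly F})) : {fraction {poly F}} :=
  if l is (n, f) :: l' then P%:F ^ n / (f%:F + cf_ev P l') else 0.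

(* The convergent x_r = [n_1, f_1, ..., n_r, f_r]_ev, seen in F((t^-1)). *)
Definition cf_conv (P : {poly F}) s (r : nat) : laurent F :=
  fracl (cf_ev P (fitake r s)).

Definition cf_value (P : {poly F}) s (z : laurent F) : Prop :=
  match s with
  | FinSeq l => z = fracl (cf_ev P l)
  | InfSeq _ => cvgl (cf_conv P s) z
  end.

Definition cf_admissible (d : nat) s : Prop :=
  forall i, lt_length i s ->
    [/\ cf_f s i \in A_ d, cf_f s i != 0
      & (0 < i)%N -> 0 < deg (cf_f s i) - cf_n s i * d%:Z].

Definition cf_expansion (P : {poly F}) (d : nat) s (z : laurent F) : Prop :=
  cf_admissible d s /\ cf_value P s z.

End ContinuedFractions.

(* Main.v *)
(* Since F[t] + (t^-1) F[[t^-1]] = F((t^-1)), each z != 0 is P^n / (f + w) for a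
   unique n in Z, a unique nonzero f of degree < d and a unique w of positive
   valuation: n is the only integer such that P^n / z has degree in [0, d), and
   f and w are its polynomial and fractional parts.  The expansion of z is
   obtained by iterating the map z |-> w, and peeling off the first digit of an
   arbitrary expansion of z leaves an expansion of w, which gives uniqueness.
   The formula for the valuation of z - x_r follows by induction on r from
   P^n / (f + w) - P^n / (f + x) = - P^n (w - x) / ((f + w) (f + x)). *)
Require Import Defs.
From mathcomp Require Import all_boot all_order all_algebra.
From mathcomp Require Import constructive_ereal.
From mathcomp Require boolp.
From mathcomp Require Import zify ring.

Set Implicit Arguments.
Unset Strict Implicit.
Unset Printing Implicit Defensive.

Import Order.TTheory GRing.Theory Num.Theory.
Local Open Scope ring_scope.

(** * Degrees, support bounds and polynomial parts of Laurent series *)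

Section LaurentDegree.
Variable F : fieldType.
Implicit Types (x y z : laurent F) (p : {poly F}) (m n M N : int).

Lemma bndl_le x M N : M <= N -> bndl x M -> bndl x N.
Proof. by move=> MN bx n Nn; apply: bx; lia. Qed.

Lemma bndl0 M : bndl (0 : laurent F) M.
Proof. by []. Qed.

Lemma bndlD x y M : bndl x M -> bndl y M -> bndl (x + y) M.
Proof. by move=> bx bY n Mn; rewrite coeflD bx// bY// addr0. Qed.

Lemma bndlN x M : bndl x M -> bndl (- x) M.
Proof. by move=> bx n Mn; rewrite coeflN bx// oppr0. Qed.

Lemma bndlM x y M N : bndl x M -> bndl y N -> bndl (x * y) (M + N).
Proof. exact: mulf_bnd. Qed.

Lemma is_degl_neq0 x m : is_degl x m -> x != 0.
Proof. by case=> xm _; apply: contraNneq xm => ->. Qed.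

Lemma is_degl_le x m M : is_degl x m -> bndl x M -> m <= M.
Proof. by case=> xm _ bx; rewrite leNgt; apply: contra_neqN xm => /bx. Qed.

Lemma is_deglN x m : is_degl x m -> is_degl (- x) m.
Proof. by case=> xm bx; split; [rewrite coeflN oppr_eq0 | apply: bndlN]. Qed.

Lemma is_deglDr x y m M : is_degl x m -> bndl y M -> M < m -> is_degl (x + y) m.
Proof.
move=> [xm bx] bY Mm; split; first by rewrite coeflD bY// addr0.
by apply: bndlD => //; apply: bndl_le bY; apply: ltW.
Qed.

Lemma is_degl1 : is_degl (1 : laurent F) 0.
Proof. by split; [rewrite coefl1 oner_eq0 | move=> n n0; rewrite coefl1 gt_eqF]. Qed.

Lemma is_deglV x m : is_degl x m -> is_degl x^-1 (- m).
Proof.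
move=> xm; have x0 := is_degl_neq0 xm.
have /deglP dV : x^-1 != 0 by rewrite invr_eq0.
have := is_deglM xm dV; rewrite mulfV// => /(is_degl_uniq is_degl1) e.
by have -> : - m = degl x^-1 by lia.
Qed.

Lemma is_deglX x m (k : nat) : is_degl x m -> is_degl (x ^+ k) (k%:Z * m).
Proof.
move=> xm; elim: k => [|k IH]; first by rewrite expr0 mul0r; apply: is_degl1.
by rewrite exprS intS mulrDl mul1r; apply: is_deglM.
Qed.

Lemma is_deglXz x m n : is_degl x m -> is_degl (x ^ n) (n * m).
Proof.
move=> xm; case: n => k; first exact: is_deglX.
by rewrite NegzE mulNr; apply: is_deglV; apply: is_deglX.
Qed.

(** Support bounds are closed under sums and products and cover 0 without a separate case, so they
    stand in for inequalities on [nu]. *)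
Lemma nu_ge x M : (M%:E <= nu x)%E <-> bndl x (- M).
Proof.
have [->|x0] := eqVneq x 0; first by rewrite nu0 leey; split.
have dx := deglP x0; rewrite (nu_eq dx) lee_fin; split => [le|/(is_degl_le dx)]; last by lia.
by case: dx => _; apply: bndl_le; lia.
Qed.

Lemma cvgl_bndl (u : nat -> laurent F) z :
  cvgl u z <-> forall M, exists R, forall r, (R <= r)%N -> bndl (z - u r) M.
Proof.
split=> uz M; have [R uR] := uz (- M); exists R => r /uR.
  by move=> /nu_ge; rewrite opprK.
by move=> bz; apply/nu_ge.
Qed.

(** Any length above the degree would do; for a negative degree the coefficients collected are all
    zero. *)
Definition polypart x : {poly F} := \poly_(i < `|degl x|.+1) x i%:Z.

Lemma coef_polypart x (i : nat) : (polypart x)`_i = x i%:Z.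
Proof.
rewrite coef_poly; case: ltnP => // iM.
have [->//|/deglP[_ bx]] := eqVneq x 0.
by rewrite bx//; lia.
Qed.

Lemma polypart0 : polypart 0 = 0.
Proof. by apply/polyP => i; rewrite coef_polypart coef0. Qed.

Lemma bndl_polypart x : bndl (x - polyl (polypart x)) (-1).
Proof. by move=> [k _|k]; [rewrite coeflB /= coef_polypart subrr | lia]. Qed.

Lemma polypart_unique p x : bndl x (-1) -> polypart (polyl p + x) = p.
Proof. by move=> bx; apply/polyP => i; rewrite coef_polypart coeflD bx// addr0. Qed.

Lemma size_polypart x m : is_degl x m -> 0 <= m -> (size (polypart x))%:Z = m + 1.
Proof.
move=> [xm bx] m0; have em : m = `|m|%N%:Z by lia.
suff -> : size (polypart x) = `|m|.+1%N by lia.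
apply/eqP; rewrite eqn_leq; apply/andP; split.
  by apply/leq_sizeP => j jm; rewrite coef_polypart bx//; lia.
by rewrite ltnNge; apply: contra_neqN xm => /leq_sizeP/(_ _ (leqnn _));
  rewrite coef_polypart -em.
Qed.

Lemma is_degl_deg p : p != 0 -> is_degl (polyl p) (deg p).
Proof. exact: is_degl_polyl. Qed.

Lemma deg_ge0 p : 0 <= deg p.
Proof. by rewrite /deg; lia. Qed.

End LaurentDegree.

(** * Shifting finite or infinite sequences *)

Section FiniteOrInfiniteSequence.
Variables (T : Type) (x0 : T).
Implicit Types s : fiseq T.

Definition fibehead s : fiseq T :=
  match s with
  | FinSeq l => FinSeq (behead l)
  | InfSeq u => InfSeq (fun i => u i.+1)
  end.

Lemma lt_length_behead s i : lt_length i (fibehead s) = lt_length i.+1 s.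
Proof. by case: s => [[|y l]|u]. Qed.

Lemma fiterm_behead s i : fiterm x0 (fibehead s) i = fiterm x0 s i.+1.
Proof. by case: s => [l|u] //=; rewrite nth_behead. Qed.

Lemma lt_length0_nil s : ~~ lt_length 0 s -> s = FinSeq [::].
Proof. by case: s => [[|y l]|u]. Qed.

Lemma lt_lengthW s i : lt_length i s -> lt_length 0 s.
Proof. by case: s => [[|y l]|u]. Qed.

Lemma fitakeS s r : lt_length 0 s ->
  fitake r.+1 s = fiterm x0 s 0 :: fitake r (fibehead s).
Proof.
by case: s => [[|y l]|u] //= _; rewrite /mkseq /= (iotaDl 1 0) -map_comp.
Qed.

Lemma all_fitake (a : pred T) s r :
  (forall i, lt_length i s -> a (fiterm x0 s i)) -> all a (fitake r s).
Proof.
elim: r s => [|r IH] s sa; first by case: s sa => [l|u] _; rewrite /= ?take0.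
have [s0|/lt_length0_nil -> //] := boolP (lt_length 0 s).
rewrite fitakeS //= sa //=; apply: IH => i.
by rewrite lt_length_behead fiterm_behead; apply: sa.
Qed.

(** At the index equal to the size of a finite list, [lt_length] tells the list from any longer or
    infinite sequence. *)
Lemma fiseq_ext s s' : (forall i, lt_length i s = lt_length i s') ->
  (forall i, lt_length i s -> fiterm x0 s i = fiterm x0 s' i) -> s = s'.
Proof.
case: s s' => [l|u] [l'|u'] eql eqt.
- have eqs : size l = size l'.
    by have := eql (size l); have := eql (size l'); rewrite /= !ltnn; lia.
  by congr FinSeq; apply: (@eq_from_nth _ x0).
- by have := eql (size l); rewrite /= ltnn.
- by have := eql (size l'); rewrite /= ltnn.
- by congr InfSeq; apply: boolp.funext => i; apply: eqt.
Qed.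

End FiniteOrInfiniteSequence.

(** * One level of the continued fraction, and its inverse *)

Section ContinuedFraction.
Variables (F : fieldType) (P : {poly F}) (d : nat).
Hypotheses (d_gt0 : (0 < d)%N) (sizeP : size P = d.+1).
Implicit Types (w x z : laurent F) (p f a b : {poly F}) (m n M N : int).
Implicit Types (c : int * {poly F}) (l : seq (int * {poly F})).
Implicit Types s : fiseq (int * {poly F}).

Definition cf_step c w : laurent F := polyl P ^ c.1 / (polyl c.2 + w).

Definition digit c := (c.2 \in A_ d) && (c.2 != 0).

(** The inequality says that [cf_step c w] has negative degree whenever [w] has. *)
Definition small_digit c := digit c && (0 < deg c.2 - c.1 * d%:Z).

Lemma P_neq0 : P != 0.
Proof. by rewrite -size_poly_gt0 sizeP. Qed.

Lemma is_degl_P : is_degl (polyl P) d.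
Proof. by have := is_degl_polyl P_neq0; rewrite sizeP. Qed.

Lemma polylP_neq0 n : polyl P ^ n != 0.
Proof. exact: is_degl_neq0 (is_deglXz n is_degl_P). Qed.

Lemma digit_deg c : digit c -> 0 <= deg c.2 < d%:Z.
Proof.
case/andP; rewrite /A_ inE -size_poly_gt0 /deg => cd c0.
by apply/andP; split; lia.
Qed.

Lemma fracl_exprz n : fracl (FracField.tofrac P ^ n) = polyl P ^ n.
Proof.
by case: n => k; rewrite ?NegzE -?exprnP -?exprnN ?fmorphV rmorphXn /= fracl_tofrac.
Qed.

Lemma fracl_cf_ev_cons c l :
  fracl (cf_ev P (c :: l)) = cf_step c (fracl (cf_ev P l)).
Proof.
by case: c => n f /=; rewrite fmorph_div rmorphD /= fracl_tofrac fracl_exprz.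
Qed.

Lemma fracl_cf_ev_nil : fracl (cf_ev P [::]) = 0.
Proof. exact: rmorph0. Qed.

Lemma is_degl_den f w : f != 0 -> bndl w (-1) -> is_degl (polyl f + w) (deg f).
Proof. by move=> f0 bw; apply: is_deglDr (is_degl_deg f0) bw _; have := deg_ge0 f; lia. Qed.

Lemma is_degl_step c w : digit c -> bndl w (-1) ->
  is_degl (cf_step c w) (c.1 * d%:Z - deg c.2).
Proof.
move=> /andP[_ c0] bw; apply: is_deglM; first exact/is_deglXz/is_degl_P.
exact/is_deglV/is_degl_den.
Qed.

Lemma cf_stepB c w x : digit c -> bndl w (-1) -> bndl x (-1) ->
  cf_step c w - cf_step c x =
    - (cf_step c w * (w - x) / (polyl c.2 + x)).
Proof.
move=> /andP[_ c0] bw bx.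
have w0 := is_degl_neq0 (is_degl_den c0 bw).
have x0 := is_degl_neq0 (is_degl_den c0 bx).
by rewrite /cf_step; field; rewrite w0 x0.
Qed.

Lemma is_degl_stepB c w x m : digit c -> bndl w (-1) -> bndl x (-1) ->
  is_degl (w - x) m ->
  is_degl (cf_step c w - cf_step c x) (c.1 * d%:Z - 2 * deg c.2 + m).
Proof.
move=> dc bw bx wx; rewrite cf_stepB//.
have -> : c.1 * d%:Z - 2 * deg c.2 + m = c.1 * d%:Z - deg c.2 + m + - deg c.2 by lia.
apply: is_deglN; apply: is_deglM; first exact/is_deglM/wx/is_degl_step.
by case/andP: dc => _ c0; apply/is_deglV/is_degl_den.
Qed.

(** Weakens [is_degl_stepB] to a bound, so that [w = x] is allowed. *)
Lemma bndl_stepB c w x M : digit c -> bndl w (-1) -> bndl x (-1) ->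
  bndl (w - x) M ->
  bndl (cf_step c w - cf_step c x) (c.1 * d%:Z - 2 * deg c.2 + M).
Proof.
move=> dc bw bx wx; have [/eqP|wx0] := eqVneq (w - x) 0.
  by rewrite subr_eq0 => /eqP ->; rewrite subrr; apply: bndl0.
have wxd := deglP wx0; have [_] := is_degl_stepB dc bw bx wxd.
by apply: bndl_le; rewrite lerD2l (is_degl_le wxd wx).
Qed.

(** Induction from the innermost digit: each denominator is a nonzero polynomial plus a series of
    negative degree, hence has the degree of that polynomial. *)
Lemma bndl_cf_ev l : all small_digit l -> bndl (fracl (cf_ev P l)) (-1).
Proof.
elim: l => [_|c l IH]; first by rewrite fracl_cf_ev_nil; apply: bndl0.
rewrite fracl_cf_ev_cons => /=/andP[/andP[dc sc] /IH bl]; case: (is_degl_step dc bl) => _.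
by apply: bndl_le; lia.
Qed.

(* For [z != 0], the only [n] with [0 <= n * d - degl z < d], so that the
   polynomial part of P^n / z is nonzero of degree < d. *)
Definition cf_exp z : int := ((degl z + d%:Z - 1) %/ d%:Z)%Z.

Definition cf_digit z := (cf_exp z, polypart (polyl P ^ cf_exp z / z)).

Definition cf_tail z : laurent F :=
  polyl P ^ (cf_digit z).1 / z - polyl (cf_digit z).2.

(** By the convention [0^-1 = 0], an orbit of [cf_tail] that reaches 0 stays there, so the length of
    an expansion can be read from which iterates vanish. *)
Lemma cf_tail0 : cf_tail 0 = 0.
Proof. by rewrite /cf_tail /= invr0 mulr0 polypart0 rmorph0 subrr. Qed.

Lemma iter_cf_tail0 i : iter i cf_tail 0 = 0.
Proof. by elim: i => //= i ->; rewrite cf_tail0. Qed.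

Lemma bndl_cf_tail z : bndl (cf_tail z) (-1).
Proof. exact: bndl_polypart. Qed.

Lemma bndl_iter_cf_tail i z : bndl z (-1) -> bndl (iter i cf_tail z) (-1).
Proof. by case: i => [|i] //= _; apply: bndl_cf_tail. Qed.

Lemma cf_exp_bounds z : 0 <= cf_exp z * d%:Z - degl z < d%:Z.
Proof.
rewrite /cf_exp; set e := degl z + _ - 1; have := divz_eq e d%:Z.
have : 0 <= (e %% d%:Z)%Z by apply: modz_ge0; lia.
have := ltz_pmod e (d := d%:Z) d_gt0.
have : e = degl z + d%:Z - 1 by [].
by move: (_ %/ _)%Z (_ %% _)%Z => q r; lia.
Qed.

Lemma cf_digitP z : z != 0 -> digit (cf_digit z).
Proof.
move=> z0; have bounds := cf_exp_bounds z.
have dq := is_deglM (is_deglXz (cf_exp z) is_degl_P) (is_deglV (deglP z0)).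
have /andP[ge0 ltd] := bounds; have := size_polypart dq ge0.
rewrite /digit /A_ inE -size_poly_gt0 /=; move: (size _) => k ek.
by apply/andP; split; lia.
Qed.

Lemma cf_step_tail z : z != 0 -> z = cf_step (cf_digit z) (cf_tail z).
Proof.
move=> z0; rewrite /cf_step /cf_tail addrC subrK.
by rewrite invf_div mulrC divfK// polylP_neq0.
Qed.

(** The degree of [z] is n d - deg f for its digit (n, f), so the required inequality just says that
    this degree is negative. *)
Lemma small_cf_digit z : z != 0 -> bndl z (-1) -> small_digit (cf_digit z).
Proof.
move=> z0 bz; have dz := cf_digitP z0; rewrite /small_digit dz.
have := is_degl_step dz (@bndl_cf_tail z); rewrite -cf_step_tail// => degz.
by have := is_degl_le degz bz; lia.
Qed.

Lemma cf_digit_unique c w : digit c -> bndl w (-1) ->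
  cf_digit (cf_step c w) = c /\ cf_tail (cf_step c w) = w.
Proof.
move=> dc bw; have dz := is_degl_step dc bw; have dd := digit_deg dc.
have /andP[_ c0] := dc.
have en : cf_exp (cf_step c w) = c.1.
  (* Both exponents n put n d - [degl z] in [0, d): for [c.1] this difference is [deg c.2]. *)
  have := cf_exp_bounds (cf_step c w); rewrite (degl_eq dz); nia.
have eq : polyl P ^ c.1 / cf_step c w = polyl c.2 + w.
  by rewrite /cf_step invf_div mulrCA mulfV ?mulr1// polylP_neq0.
rewrite /cf_tail /cf_digit en eq /= polypart_unique// addrAC subrr add0r.
by case: (c).
Qed.

(** * Convergents of admissible sequences and their limits *)

Lemma cf_conv0 s : cf_conv P s 0 = 0.
Proof. by case: s => [l|u]; rewrite /cf_conv /= ?take0 rmorph0. Qed.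

Lemma cf_convS s r : lt_length 0 s ->
  cf_conv P s r.+1 = cf_step (fiterm (0, 0) s 0) (cf_conv P (fibehead s) r).
Proof. by move=> s0; rewrite /cf_conv (fitakeS (0, 0))// fracl_cf_ev_cons. Qed.

(** The inequality is imposed from the second digit on; after a shift it holds at every index, which
    is what inductions on tails use. *)
Lemma admissibleP s : cf_admissible d s <->
  (lt_length 0 s -> digit (fiterm (0, 0) s 0)) /\
  (forall i, lt_length i (fibehead s) -> small_digit (fiterm (0, 0) (fibehead s) i)).
Proof.
split=> [sadm|[s0 sS] [|i] si].
- split=> [/sadm[Ad f0 _]|i]; first by rewrite /digit Ad f0.
  rewrite lt_length_behead fiterm_behead => /sadm[Ad f0 /(_ isT) pos].
  by rewrite /small_digit /digit Ad f0.
- by have /andP[] := s0 si.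
- have := sS i; rewrite lt_length_behead fiterm_behead => /(_ si).
  by move=> /andP[/andP[Ad f0] pos].
Qed.

Lemma admissible_small s :
  (forall i, lt_length i s -> small_digit (fiterm (0, 0) s i)) -> cf_admissible d s.
Proof.
move=> ss; apply/admissibleP; split=> [/ss/andP[]//|i].
by rewrite lt_length_behead fiterm_behead; apply: ss.
Qed.

Lemma bndl_conv_behead s r : cf_admissible d s ->
  bndl (cf_conv P (fibehead s) r) (-1).
Proof. by move=> /admissibleP[_ ss]; apply: bndl_cf_ev; apply: all_fitake ss. Qed.

(** The inverse of [cf_step c], sending y to P^n / y - f, is continuous away from 0, and the limit
    [z] is nonzero because all approximants have the same degree [e]. *)
Lemma cvgl_tail (x : nat -> laurent F) c z : digit c ->
  (forall r, bndl (x r) (-1)) -> cvgl (fun r => cf_step c (x r)) z ->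
  exists w, [/\ z = cf_step c w, bndl w (-1) & cvgl x w].
Proof.
move=> dc bx /cvgl_bndl cz; pose e := c.1 * d%:Z - deg c.2.
have dx r : is_degl (cf_step c (x r)) e by apply: is_degl_step.
have dz : is_degl z e.
  (* One approximant with error of degree below [e] already fixes the degree of [z]. *)
  have [R /(_ R (leqnn R)) zR] := cz (e - 1).
  by rewrite -(subrK (cf_step c (x R)) z) addrC; apply: is_deglDr zR _ => //; lia.
have z0 := is_degl_neq0 dz.
pose w := polyl P ^ c.1 / z - polyl c.2.
have wx r : w - x r =
    - (polyl P ^ c.1 * (z - cf_step c (x r)) / (z * cf_step c (x r))).
  have := is_degl_neq0 (dx r); set y := cf_step c (x r) => y0.
  have -> : x r = polyl P ^ c.1 / y - polyl c.2.
    by rewrite /y /cf_step invf_div mulrCA mulfV ?polylP_neq0// mulr1 addrC addKr.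
  by rewrite /w; field; rewrite z0 y0.
have cw : cvgl x w.
  (* In [wx] the factor P^n has degree n d and the inverse denominator has degree -2e; the precision
     asked of [z] compensates for both. *)
  apply/cvgl_bndl => M; have [R zR] := cz (M - c.1 * d%:Z + 2 * e).
  exists R => r /zR zr; rewrite wx; apply: bndlN.
  have [_ bV] := is_deglV (is_deglM dz (dx r)).
  have [_ bP] := is_deglXz c.1 is_degl_P.
  by apply: bndl_le (bndlM (bndlM bP zr) bV); lia.
exists w; split=> //.
  by rewrite /cf_step /w addrC subrK invf_div mulrCA mulfV ?mulr1// polylP_neq0.
move/cvgl_bndl: cw => /(_ (-1))[R /(_ R (leqnn R)) wR].
by rewrite -(subrK (x R) w); apply: bndlD.
Qed.

(** * Peeling off digits; uniqueness and the error formula *)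

Lemma expansion_nil z : cf_expansion P d (FinSeq [::]) z <-> z = 0.
Proof.
rewrite /cf_expansion /cf_value fracl_cf_ev_nil; split=> [[]//|->].
by split=> // i; rewrite ltn0.
Qed.

Lemma expansion_behead s z : cf_expansion P d s z -> lt_length 0 s ->
  [/\ z != 0, fiterm (0, 0) s 0 = cf_digit z
    & cf_expansion P d (fibehead s) (cf_tail z)].
Proof.
move=> [sadm sz] s0; have [/(_ s0) dc ss] := (admissibleP s).1 sadm.
suff [w [ez bw vw]] : exists w, [/\ z = cf_step (fiterm (0, 0) s 0) w,
    bndl w (-1) & cf_value P (fibehead s) w].
  have := cf_digit_unique dc bw; rewrite -ez => -[-> ->]; split.
  - by rewrite ez; apply: is_degl_neq0 (is_degl_step dc bw).
  - by [].
  - by split=> //; apply: admissible_small.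
have bconv r := bndl_conv_behead r sadm.
case: s s0 sadm sz dc {ss} bconv => [[//|c l]|u] /= _ sadm sz dc bconv.
  exists (fracl (cf_ev P l)); split=> //; first by rewrite sz fracl_cf_ev_cons.
  by have := bconv (size l); rewrite /cf_conv /= take_size.
apply: cvgl_tail => // M; have [R uR] := sz M; exists R => r Rr.
have -> : cf_step (u 0%N) (cf_conv P (InfSeq (fun i => u i.+1)) r) =
    cf_conv P (InfSeq u) r.+1 by rewrite cf_convS.
by apply: uR; apply: leqW.
Qed.

(** Both the length and the digits are read off the [cf_tail] orbit of [z]: this gives uniqueness,
    and makes finiteness equivalent to the orbit reaching 0. *)
Lemma expansion_iter i s z : cf_expansion P d s z ->
  (lt_length i s = (iter i cf_tail z != 0)) /\
  (lt_length i s -> fiterm (0, 0) s i = cf_digit (iter i cf_tail z)).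
Proof.
elim: i s z => [|i IH] s z sz.
  have [s0|/lt_length0_nil s0] := boolP (lt_length 0 s).
    by have [z0 ed _] := expansion_behead sz s0; rewrite /= z0.
  by move: sz; rewrite s0 => /expansion_nil ->; rewrite /= eqxx.
have [s0|/lt_length0_nil s0] := boolP (lt_length 0 s).
  have [z0 ed sz'] := expansion_behead sz s0.
  by have := IH _ _ sz'; rewrite lt_length_behead fiterm_behead -iterSr.
by move: sz; rewrite s0 => /expansion_nil ->; rewrite iter_cf_tail0 eqxx.
Qed.

Lemma expansion_unique s s' z :
  cf_expansion P d s z -> cf_expansion P d s' z -> s = s'.
Proof.
move=> sz sz'; apply: (@fiseq_ext _ (0, 0)) => i.
  by rewrite (expansion_iter i sz).1 (expansion_iter i sz').1.
move=> si; rewrite (expansion_iter i sz).2//.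
by rewrite (expansion_iter i sz').2// (expansion_iter i sz').1
  -(expansion_iter i sz).1.
Qed.

(** Each of the first r digits adds n d - 2 deg f to the degree of the error. The last one adds n d
    - deg f only, since x_0 = 0 leaves a whole complete quotient as error. *)
Lemma is_degl_sub_conv s z r : cf_expansion P d s z -> lt_length r s ->
  is_degl (z - cf_conv P s r)
    (\sum_(0 <= i < r.+1) cf_n s i * d%:Z
       - (2 * (\sum_(0 <= i < r) deg (cf_f s i)) + deg (cf_f s r))).
Proof.
elim: r s z => [|r IH] s z sz sr; have s0 := lt_lengthW sr;
  have [z0 ed sz'] := expansion_behead sz s0.
  rewrite cf_conv0 subr0 big_nat1 big_geq// mulr0 add0r /cf_n /cf_f ed.
  by rewrite {1}(cf_step_tail z0); apply: is_degl_step (cf_digitP z0) (@bndl_cf_tail z).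
rewrite cf_convS// ed {1}(cf_step_tail z0).
have sr' : lt_length r (fibehead s) by rewrite lt_length_behead.
have := is_degl_stepB (cf_digitP z0) (@bndl_cf_tail z)
  (bndl_conv_behead r sz.1) (IH _ _ sz' sr').
have en i : cf_n (fibehead s) i = cf_n s i.+1 by rewrite /cf_n fiterm_behead.
have ef i : cf_f (fibehead s) i = cf_f s i.+1 by rewrite /cf_f fiterm_behead.
congr is_degl; rewrite -ed ef.
rewrite (eq_bigr (fun i => cf_n s i.+1 * d%:Z)) => [|i _]; last by rewrite en.
rewrite [X in 2 * X + _](eq_bigr (fun i => deg (cf_f s i.+1))) => [|i _]; last by rewrite ef.
rewrite [in RHS](big_nat_recl r.+1)// [X in _ = _ - (2 * X + _)](big_nat_recl r)//.
by rewrite mulrDr /cf_n /cf_f; ring.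
Qed.

(** * Existence of the expansion *)

Definition cf_digits z r := mkseq (fun i => cf_digit (iter i cf_tail z)) r.

Lemma cf_digitsS z r : cf_digits z r.+1 = cf_digit z :: cf_digits (cf_tail z) r.
Proof.
rewrite /cf_digits /mkseq /= (iotaDl 1 0) -map_comp.
by congr (_ :: _); apply: eq_map => i; rewrite /= -iterS iterSr.
Qed.

Lemma small_cf_digits z r : (forall i, (i < r)%N -> iter i cf_tail z != 0) ->
  bndl z (-1) -> all small_digit (cf_digits z r).
Proof.
move=> nz bz; rewrite all_map; apply/allP => i; rewrite mem_iota add0n => /= ir.
by apply: small_cf_digit; [apply: nz | apply: bndl_iter_cf_tail].
Qed.

Lemma cf_ev_digits z k : (forall i, (i < k)%N -> iter i cf_tail z != 0) ->
  iter k cf_tail z = 0 -> fracl (cf_ev P (cf_digits z k)) = z.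
Proof.
elim: k z => [|k IH] z nz zk; first by rewrite [RHS]zk fracl_cf_ev_nil.
rewrite cf_digitsS fracl_cf_ev_cons IH -?iterSr//.
  by rewrite -cf_step_tail//; apply: (nz 0%N).
by move=> i ik; rewrite -iterSr; apply: nz.
Qed.

(** The step shifts the bound by n d - 2 deg f, at most the degree n d - deg f of [z], hence at most
    [M]; the tail starts from the bound -1, so every digit gains at least one unit. *)
Lemma bndl_sub_digits z M r : (forall i, iter i cf_tail z != 0) -> bndl z M ->
  bndl (z - fracl (cf_ev P (cf_digits z r))) (M - r%:Z).
Proof.
elim: r z M => [|r IH] z M nz bz; first by rewrite fracl_cf_ev_nil !subr0.
have nzt i : iter i cf_tail (cf_tail z) != 0 by rewrite -iterSr.
have z0 : z != 0 := nz 0%N; have dc := cf_digitP z0; have bt := @bndl_cf_tail z.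
have degz := is_degl_step dc bt; rewrite -cf_step_tail// in degz.
have be := bndl_cf_ev (@small_cf_digits _ r (fun i _ => nzt i) bt).
rewrite cf_digitsS fracl_cf_ev_cons {1}(cf_step_tail z0).
apply: bndl_le (bndl_stepB dc bt be (IH _ _ nzt bt)).
by have := is_degl_le degz bz; have := deg_ge0 (cf_digit z).2; lia.
Qed.

Lemma admissible_cf_digit s z :
  (forall i, lt_length i s -> iter i cf_tail z != 0) ->
  (forall i, lt_length i s -> fiterm (0, 0) s i = cf_digit (iter i cf_tail z)) ->
  cf_admissible d s.
Proof.
move=> nz sz i si; rewrite /cf_f /cf_n sz//.
have /andP[Ad f0] := cf_digitP (nz i si); split=> //.
case: i si {Ad f0} => // i si _.
by have /andP[_] := small_cf_digit (nz _ si) (@bndl_cf_tail _).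
Qed.

Lemma expansion_exists z : exists s, cf_expansion P d s z.
Proof.
have [ex0|nex0] := boolp.pselect (exists k, iter k cf_tail z == 0).
  (* Stopping at the first zero of the orbit ensures that every digit kept comes from a nonzero
     complete quotient. *)
  case: (ex_minnP ex0) => k /eqP zk kmin.
  have nz i : (i < k)%N -> iter i cf_tail z != 0.
    by move=> ik; apply/negP => /kmin; rewrite leqNgt ik.
  exists (FinSeq (cf_digits z k)); split; last by rewrite /= cf_ev_digits.
  by apply: (@admissible_cf_digit _ z) => i /=; rewrite size_mkseq;
    [apply: nz | apply: nth_mkseq].
have nz i : iter i cf_tail z != 0 by apply/negP => zi; apply: nex0; exists i.
exists (InfSeq (fun i => cf_digit (iter i cf_tail z))); split.
  by apply: (@admissible_cf_digit _ z).
have [b bz] := coefl_bounded z.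
apply/cvgl_bndl => M; exists `|b - M|%N => r rM.
by have := bndl_sub_digits (r := r) nz bz; apply: bndl_le; lia.
Qed.

(** * Termination for rational functions *)

Lemma size_Pexp_mul a (m : nat) : a != 0 ->
  size (P ^+ m * a) = (m * d + size a)%N.
Proof.
move=> a0; elim: m => [|m IH]; first by rewrite mul1r.
rewrite exprS -mulrA size_mul ?P_neq0 ?mulf_neq0 ?expf_neq0 ?P_neq0//.
by rewrite IH sizeP mulSn addSn addnA.
Qed.

(** A step of Euclidean type: as a / b has negative degree, its exponent is -m with m nonnegative,
    and b is divided by P^m a with quotient f. *)
Lemma cf_tail_frac a b : a != 0 -> b != 0 ->
  bndl (polyl a / polyl b) (-1) -> exists (m : nat) (f : {poly F}),
  [/\ cf_tail (polyl a / polyl b) =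
        polyl (b - f * (P ^+ m * a)) / polyl (P ^+ m * a),
      (size (P ^+ m * a)%R + (size f).-1)%N = size b
    & (0 < m)%N || (1 < size f)%N].
Proof.
move=> a0 b0; set z := polyl a / polyl b => bz.
have [la lb] : polyl a != 0 /\ polyl b != 0 by rewrite !polyl_eq0.
have z0 : z != 0 by rewrite mulf_neq0 ?invr_eq0.
have /andP[dc sc] := small_cf_digit z0 bz; have dd := digit_deg dc.
(* From n d < deg f < d. *)
have n0 : (cf_digit z).1 <= 0 by nia.
pose m := `|(cf_digit z).1|%N; have en : (cf_digit z).1 = - m%:Z by lia.
exists m, (cf_digit z).2; split.
- have Pm0 : polyl P ^+ m != 0 by rewrite expf_neq0// polyl_eq0 P_neq0.
  rewrite /cf_tail en -exprnN /z rmorphB !rmorphM rmorphXn /=.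
  move: (polyl _) (polyl _) (polyl _) (_ ^+ _) la lb Pm0 => x y f p x0 y0 p0.
  by field; rewrite p0 x0 y0.
- have degz := is_degl_step dc (@bndl_cf_tail z); rewrite -cf_step_tail// in degz.
  have := is_degl_uniq degz
    (is_deglM (is_degl_polyl a0) (is_deglV (is_degl_polyl b0))).
  rewrite size_Pexp_mul// en /deg; move: a0 b0; rewrite -!size_poly_gt0.
  by lia.
- by move: sc; rewrite en /deg; lia.
Qed.

(* The size of the denominator never increases along the complete quotients,
   and it decreases at a digit of positive degree.  At two consecutive constant
   digits both exponents are negative, and P cancels from the fraction. *)
Lemma cf_tail_terminates k a b : (size b <= k)%N -> b != 0 ->
  bndl (polyl a / polyl b) (-1) -> exists i, iter i cf_tail (polyl a / polyl b) = 0.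
Proof.
elim: k a b => [|k IH] a b bk b0 bz.
  by move: bk; rewrite leqn0 size_poly_eq0 (negPf b0).
have [->|a0] := eqVneq a 0; first by exists 0%N; rewrite /= rmorph0 mul0r.
have [m [f [et es mf]]] := cf_tail_frac a0 b0 bz.
set b' := P ^+ m * a in et es; set a' := b - f * b' in et.
have b'0 : b' != 0 by rewrite mulf_neq0// expf_neq0// P_neq0.
have bz' : bndl (polyl a' / polyl b') (-1) by rewrite -et; apply: bndl_cf_tail.
(* For a digit of positive degree, [es] makes [b'] strictly smaller than [b]. *)
have [f1|f1] := ltnP 1 (size f).
  have [|i ti] := IH a' b' _ b'0 bz'; first by lia.
  by exists i.+1; rewrite iterSr et.
have [a'0|a'0] := eqVneq a' 0.
  by exists 1%N; rewrite /= et a'0 rmorph0 mul0r.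
have [m' [f' [et' es' mf']]] := cf_tail_frac a'0 b'0 bz'.
set b2 := P ^+ m' * a' in et' es'; set a2 := b' - f' * b2 in et'.
have b20 : b2 != 0 by rewrite mulf_neq0// expf_neq0// P_neq0.
have bz2 : bndl (polyl a2 / polyl b2) (-1) by rewrite -et'; apply: bndl_cf_tail.
have [f1'|f1'] := ltnP 1 (size f').
  have [|i ti] := IH a2 b2 _ b20 bz2; first by lia.
  by exists i.+2; rewrite !iterSr et et'.
(* Both digits are now constant, so [mf] and [mf'] force positive exponents of P. *)
have m_gt0 : (0 < m)%N by lia.
have m'_gt0 : (0 < m')%N by lia.
pose b3 := P ^+ m'.-1 * a'; pose a3 := P ^+ m.-1 * a - f' * b3.
have eb : b2 = P * b3 by rewrite /b2 /b3 mulrA -exprS prednK.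
have ea : a2 = P * a3.
  by rewrite /a2 /a3 eb mulrBr [P * (_ * a)]mulrA -exprS prednK// [f' * (P * _)]mulrCA.
have b30 : b3 != 0 by apply: contraNneq b20 => b30; rewrite eb b30 mulr0.
have lP : polyl P != 0 by rewrite polyl_eq0 P_neq0.
have e3 : polyl a2 / polyl b2 = polyl a3 / polyl b3.
  by rewrite ea eb !rmorphM /= -mulf_div mulfV// mul1r.
have [||i ti] := IH a3 b3 _ b30.
(* Here [b2] has the same size as [b], and dividing by P lowers it by d. *)
- have := size_Pexp_mul 1 b30; rewrite expr1 -eb; lia.
- by rewrite -e3.
by exists i.+2; rewrite !iterSr et et' e3.
Qed.

Lemma cf_tail_fracl_terminates (x : {fraction {poly F}}) :
  exists i, iter i cf_tail (fracl x) = 0.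
Proof.
have et n f : polyl P ^ n / fracl x - polyl f =
    fracl (FracField.tofrac P ^ n / x - FracField.tofrac f).
  by rewrite rmorphB fmorph_div /= fracl_exprz fracl_tofrac.
(* [cf_tail_terminates] needs a fraction of negative degree; the first tail is one, whatever the
   degree of [x]. *)
have bt := @bndl_cf_tail (fracl x); rewrite /cf_tail et /fracl in bt.
have [i ti] := cf_tail_terminates (leqnn _) (denom_ratioP _) bt.
exists i.+1; rewrite iterSr -[RHS]ti; congr (iter i cf_tail _).
exact: et.
Qed.

End ContinuedFraction.

Theorem theorem1p1 (F : fieldType) (P : {poly F}) (d : nat)
    (d_ge1 : (1 <= d)%N) (degP : size P = d.+1)
    (z : laurent F) (z_neq0 : z != 0) :
  (exists! s : fiseq (int * {poly F}), cf_expansion P d s z) /\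
  (forall s : fiseq (int * {poly F}), cf_expansion P d s z ->
     (is_fin s <-> exists x : {fraction {poly F}}, z = fracl x) /\
     (forall r : nat, lt_length r s ->
        nu (z - cf_conv P s r) =
          (2 * (\sum_(0 <= i < r) deg (cf_f s i)) + deg (cf_f s r)
             - \sum_(0 <= i < r.+1) cf_n s i * d%:Z)%:E)).
Proof.
split.
  have [s sz] := expansion_exists d_ge1 degP z.
  by exists s; split=> // s' sz'; apply: (expansion_unique d_ge1 degP sz sz').
move=> s sz; split; last first.
  move=> r sr; rewrite (nu_eq (is_degl_sub_conv d_ge1 degP sz sr)).
  by rewrite opprB.
split=> [|[x zx]].
  by case: s sz => // l [_ /= ->] _; exists (cf_ev P l).
have [i zi] := cf_tail_fracl_terminates d_ge1 degP x.
have [] := expansion_iter d_ge1 degP i sz.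
(* The orbit vanishes at [i], so [lt_length i s] is false, which excludes an infinite [s]. *)
by rewrite zx zi eqxx; case: (s).
Qed.
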